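(* For $d\ge1$ let $\mathrm{St}_d\subset\mathbb{R}^d$ be the convex hull of $$\{\pm e_i : 1\le i\le d\}\cup\{e_i+\cdots+e_j : 1\le i<j\le d\}$$ (the dual polytope of the Stasheff polytope, or associahedron), and let $H_{\mathrm{St}_d}$ be its Ehrhart polynomial, with $H_{\mathrm{St}_0}=1$. Then $$H_{\mathrm{St}_d}(m)=\frac{2d+1}{d(d+2)}(2m+1)H_{\mathrm{St}_{d-1}}(m)+\frac{(d-1)(d+1)}{d(d+2)}H_{\mathrm{St}_{d-2}}(m)\quad\text{for all } d\ge2.$$ Moreover, for every $d\ge1$, $H_{\mathrm{St}_d}$ has all its complex roots on the line $R=\{z\in\mathbb{C}:\operatorname{Re}(z)=-\tfrac12\}$, and $H_{\mathrm{St}_{d+1}}$ is $R$-interlaced by $H_{\mathrm{St}_d}$.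
   Context: Here $e_1,\dots,e_d$ is the standard basis of $\mathbb{R}^d$. The Ehrhart polynomial $H_P$ of a lattice polytope $P\subset\mathbb{R}^d$ is the polynomial with $H_P(s)=|sP\cap\mathbb{Z}^d|$ for all integers $s\ge0$. It is a known result (recalled, not part of the claim) that $H_{\mathrm{St}_d}(m)=\sum_{k=0}^d\frac{1}{d+1}\binom{d+1}{k+1}\binom{d+1}{k}\binom{m+d-k}{d}$. Interlacing: let $L=\alpha+\mathbb{R}\beta$ be a line in $\mathbb{C}$ ($\alpha,\beta\in\mathbb{C}$, $\beta\ne0$), and let $f,g\in\mathbb{C}[x]$ with $m=\deg f=\deg g+1$ have all their zeros on $L$. Let $\alpha+t_1\beta,\dots,\alpha+t_m\beta$ and $\alpha+s_1\beta,\dots,\alpha+s_{m-1}\beta$ ($t_i,s_j\in\mathbb{R}$) be the zeros of $f$ and $g$, listed with multiplicity. Then $f$ is $L$-interlaced by $g$ if, after relabeling, $t_1\le s_1\le t_2\le\cdots\le t_{m-1}\le s_{m-1}\le t_m$. *)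

(* Defs.v *)
(* Built on MathComp and MathComp-Analysis; complex numbers are [R[i]] from
   mathcomp-real-closed, over an arbitrary [R : realType]. *)
From HB Require Import structures.
From mathcomp Require Import all_boot all_order all_algebra.
From mathcomp Require Import all_classical all_reals.
From mathcomp Require Import convex.
From mathcomp Require Import complex.

Set Implicit Arguments.
Unset Strict Implicit.
Unset Printing Implicit Defensive.

Import Order.TTheory GRing.Theory Num.Theory.

Local Open Scope classical_set_scope.
Local Open Scope ring_scope.
Local Open Scope complex_scope.

Definition convex_hull (R : realType) (E : lmodType R) (A : set E) : set E :=
  smallest (@convex_set R E) A.

Definition std_basis (R : realType) (d : nat) (i : 'I_d) : 'rV[R]_d :=
  delta_mx 0 i.

Definition stasheff_vertices (R : realType) (d : nat) : set 'rV[R]_d :=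
  [set v | (exists i : 'I_d, v = std_basis R i \/ v = - std_basis R i) \/
           (exists i j : 'I_d, (i < j)%N /\
              v = \sum_(k < d | (i <= k <= j)%N) std_basis R k)].
Arguments stasheff_vertices : clear implicits.

Definition stasheff_dual (R : realType) (d : nat) : set 'rV[R]_d :=
  convex_hull (stasheff_vertices R d).
Arguments stasheff_dual : clear implicits.

(* The integer vectors z whose image in R^d lies in s P. *)
Definition dilate_lattice_points (R : realType) (d : nat) (P : set 'rV[R]_d)
    (s : nat) : set 'rV[int]_d :=
  [set z | [set s%:R *: x | x in P] (map_mx intr z)].

Definition is_ehrhart_poly (R : realType) (d : nat) (P : set 'rV[R]_d)
    (p : {poly R[i]}) : Prop :=
  forall s : nat, exists n : nat,
    (dilate_lattice_points P s #= `I_n)%card /\ p.[s%:R] = n%:R.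

(* A polynomial is determined by its values at the naturals, so this is the
   Ehrhart polynomial of P whenever P has one; the default 0 is junk. *)
Definition ehrhart_poly (R : realType) (d : nat) (P : set 'rV[R]_d) :
    {poly R[i]} :=
  xget 0 [set p | is_ehrhart_poly P p].

(* In dimension 0 the vertex set is empty, so the value there is a convention. *)
Definition stasheff_ehrhart (R : realType) (d : nat) : {poly R[i]} :=
  if d is 0 then 1 else ehrhart_poly (stasheff_dual R d).

Definition complex_line (R : realType) (alpha beta : R[i]) : set R[i] :=
  [set alpha + t%:C * beta | t in [set: R]].

(* rs lists the zeros of f, each repeated according to its multiplicity. *)
Definition zeros_with_mult (R : realType) (f : {poly R[i]}) (rs : seq R[i]) :
    Prop :=
  f != 0 /\ forall z, count_mem z rs = mup z f.

(* f is L-interlaced by g. Since the lists t and s run over the parameters of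
   all the zeros of f and g, both polynomials have all their zeros on L. The
   order on L given by a parametrization is unique up to reversal, under which
   the condition is invariant, so the choice of alpha and beta is immaterial. *)
Definition line_interlaced (R : realType) (L : set R[i]) (f g : {poly R[i]}) :
    Prop :=
  exists alpha beta : R[i],
    [/\ beta != 0, L = complex_line alpha beta, size f = (size g).+1 &
        exists t s : seq R,
          [/\ zeros_with_mult f [seq alpha + x%:C * beta | x <- t],
              zeros_with_mult g [seq alpha + x%:C * beta | x <- s],
              size t = (size s).+1 &
              forall k, (k < size s)%N -> t`_k <= s`_k <= t`_k.+1]].

Definition critical_line (R : realType) : set R[i] :=
  [set z | complex.Re z = - 2^-1].
Arguments critical_line : clear implicits.

(* Main.v *)
(** The gauge of St_d is a sum of terms max(0, x_i - x_(i-1), - x_(i-1)), and it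
    is integral on lattice points; hence a lattice point lies in s St_d iff the
    integer [cost] of its coordinates is at most s. Counting these points
    coordinate by coordinate is a transfer-matrix recursion, which the kernel
    method solves: the counting function is
    sum_k C(d, k) C(d+k+2, k) / (k+1) C(s, k), and the three-term recurrence
    holds coefficientwise in the basis C(s, k). On Re z = -1/2 put
    z = (-1 + i x) / 2. Then H_d(z) = i^d Q_d(x), where Q_d is real and satisfies
    Q_(d+1) = a x Q_d - b Q_(d-1) with a, b > 0, so that the roots of the Q_d are
    real, simple and interlacing by the intermediate value theorem. *)

Require Import Defs.
From mathcomp Require Import all_boot all_order all_algebra.
From mathcomp Require Import all_classical all_reals.
From mathcomp Require Import complex interval_inference polyrcf.
From mathcomp Require Import zify ring.

Set Implicit Arguments.
Unset Strict Implicit.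
Unset Printing Implicit Defensive.

Import Order.TTheory GRing.Theory Num.Theory.

Local Open Scope classical_set_scope.
Local Open Scope ring_scope.

(** * Counting by transfer matrices *)

(* With y = mu (1 - t mu) / (1 + mu) and t = q / (1 - q), this is the coefficient
   of y^d q^s in (1 + mu)^A (1 - t mu)^(-B) / (1 - q): the kernel method shows
   that [A = a.+1], [B = 2] counts the points of cost at most s starting from
   level a, see [size_cost_ball]. *)
Fixpoint path_count (d A B s : nat) : nat :=
  if d is e.+1 then
    (\sum_(i < A) path_count e i.+1 B.+1 s
     + \sum_(j < B) \sum_(n < s) path_count e 1 j.+2 n)%N
  else 1%N.

Arguments path_count : simpl never.

Lemma path_countS d A B s : path_count d.+1 A B s =
  (\sum_(i < A) path_count d i.+1 B.+1 s
   + \sum_(j < B) \sum_(n < s) path_count d 1 j.+2 n)%N.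
Proof. by []. Qed.

(** For the generating functions this is mu = y (1 + mu) / (1 - t mu), multiplied by (1 + mu)^A (1 -
    t mu)^(-B) / (1 - q). *)
Lemma path_countSl d A B s :
  path_count d.+1 A.+1 B s
  = (path_count d.+1 A B s + path_count d A.+1 B.+1 s)%N.
Proof. by rewrite !path_countS big_ord_recr /= addnAC. Qed.

(** Here t mu = t y (1 + mu) / (1 - t mu) is multiplied by (1 + mu)^A (1 - t mu)^(-B-1) / (1 - q);
    the factor t becomes the sum over n < s. The definition lowers B only once A is 0, and the
    induction shows that both orders of lowering agree. *)
Lemma path_countSr d A B s :
  path_count d.+1 A B.+1 s
  = (path_count d.+1 A B s + \sum_(n < s) path_count d A.+1 B.+2 n)%N.
Proof.
elim: d A B s => [|d IHd] A B s.
  by rewrite !path_countS [X in (_ + X)%N = _]big_ord_recr addnA.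
elim: A => [|A IHA].
  by rewrite !path_countS !big_ord0 !add0n [LHS]big_ord_recr.
have -> : (\sum_(n < s) path_count d.+1 A.+2 B.+2 n
          = \sum_(n < s) path_count d.+1 A.+1 B.+2 n
            + \sum_(n < s) path_count d A.+2 B.+3 n)%N.
  by rewrite -big_split; apply: eq_bigr => n _; rewrite path_countSl.
rewrite !(path_countSl d.+1) IHA (IHd A.+1 B.+1); lia.
Qed.

(** This encodes (1 - t mu) + t (1 + mu) = 1 + t = 1 / (1 - q); the factor 1 / (1 - q) becomes the
    sum over n <= s. *)
Lemma path_count2 d A s :
  (path_count d A 2 s + \sum_(n < s) path_count d A.+1 3 n
   = \sum_(n < s.+1) path_count d A 3 n)%N.
Proof.
case: d => [|d].
  by rewrite /path_count !sum_nat_const !card_ord !muln1 add1n.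
have -> : (\sum_(n < s) path_count d.+1 A.+1 3 n
          = \sum_(n < s) path_count d.+1 A 3 n
            + \sum_(n < s) path_count d A.+1 4 n)%N.
  by rewrite -big_split; apply: eq_bigr => n _; rewrite path_countSl.
rewrite big_ord_recr /= (path_countSr d A 2); exact: addnCA.
Qed.

(** One transfer step from level a: an entry b >= 0 costs the truncated difference b - a and leads
    to level b; an entry -(n+1) costs n + 1 and leads to level 0. *)
Lemma path_count_transfer d a s :
  (\sum_(b < (a + s).+1) path_count d b.+1 2 (s - (b - a))
   + \sum_(n < s) path_count d 1 2 (s - n.+1)
   = path_count d.+1 a.+1 2 s)%N.
Proof.
pose E A m := (\sum_(n < m) path_count d A 3 n)%N.
have E2 A m : (path_count d A 2 m + E A.+1 m = E A m.+1)%N := path_count2 d A m.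
(* Iterating [E2] raises A and lowers m by one until m = 0. *)
have high m b : (\sum_(c < m) path_count d (b + c).+2 2 (m - c.+1) = E b.+2 m)%N.
  elim: m b => [|m IHm] b; first by rewrite /E !big_ord0.
  rewrite big_ord_recl /= addn0 subn1 /= -E2; congr (_ + _)%N.
  rewrite -(IHm b.+1); apply: eq_bigr => c _.
  by rewrite /bump /= add1n addnS addSn.
(* Now [E2] telescopes in A at fixed s; for m = a + 1 the boundary term [E m.+1 s] is the sum over
   the levels above a. *)
have low m : (\sum_(b < m) path_count d b.+1 2 s + E m.+1 s
   = \sum_(b < m) path_count d b.+1 3 s + E 1%N s)%N.
  elim: m => [|m IHm]; first by rewrite !big_ord0.
  rewrite !big_ord_recr /= -addnA E2 /E big_ord_recr /= -/(E m.+1 s).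
  by rewrite addnA IHm addnAC.
rewrite -addSn big_split_ord /=.
have -> : (\sum_(i < s) path_count d (a.+1 + i).+1 2 (s - (a.+1 + i - a))
          = E a.+2 s)%N.
  rewrite -high; apply: eq_bigr => c _; rewrite addSn; congr path_count; lia.
have -> : (\sum_(b < a.+1) path_count d b.+1 2 (s - (b - a))
          = \sum_(b < a.+1) path_count d b.+1 2 s)%N.
  apply: eq_bigr => b _; congr path_count; have := ltn_ord b; lia.
rewrite low.
have -> : (\sum_(n < s) path_count d 1 2 (s - n.+1)
          = \sum_(n < s) path_count d 1 2 n)%N.
  by rewrite [RHS](reindex_inj rev_ord_inj).
rewrite path_countS [X in _ = (_ + X)%N]big_ord_recl big_ord1 -addnA.
by congr (_ + _)%N; apply: addnC.
Qed.

(* [cost 0 x] is sum_i x_i^- + sum_i (x_i^+ - x_(i-1)^+)^+, the least number of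
   vertices of St_d whose sum is x. *)
Definition step (a : nat) (x : int) : nat :=
  match x with Posz b => b - a | Negz n => n.+1 end.

Definition level (x : int) : nat := if x is Posz b then b else 0.

Fixpoint cost (a : nat) (l : seq int) : nat :=
  if l is x :: l' then step a x + cost (level x) l' else 0.

Definition heads (a s : nat) : seq int :=
  [seq Posz b | b <- iota 0 (a + s).+1] ++ [seq Negz n | n <- iota 0 s].

Fixpoint cost_ball (d a s : nat) : seq (seq int) :=
  if d is e.+1 then
    [seq x :: l | x <- heads a s, l <- cost_ball e (level x) (s - step a x)]
  else [:: [::]].

Lemma mem_heads a s x : (x \in heads a s) = (step a x <= s)%N.
Proof.
have injP : injective Posz by move=> ? ? [].
have injN : injective Negz by move=> ? ? [].
rewrite mem_cat; case: x => n.
  rewrite (mem_map injP) mem_iota orbC; case: mapP => [[] //|_] /=; lia.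
rewrite (mem_map injN) mem_iota; case: mapP => [[] //|_] /=; lia.
Qed.

Lemma heads_uniq a s : uniq (heads a s).
Proof.
rewrite cat_uniq !map_inj_uniq ?iota_uniq ?andbT /=; try by move=> ? ? [].
by apply/hasPn => _ /mapP[n _ ->]; apply/mapP => -[].
Qed.

Lemma mem_cost_ball d a s l :
  (l \in cost_ball d a s) = (size l == d) && (cost a l <= s)%N.
Proof.
elim: d a s l => [|d IHd] a s l; first by rewrite inE; case: l.
apply/allpairsPdep/idP => [[x [l' [xh l'b ->]]]|].
  move: l'b; rewrite IHd /= => /andP[/eqP-> c]; rewrite eqxx /=.
  by move: xh; rewrite mem_heads => h; lia.
case: l => [//|x l'] /= /andP[/eqP[sl] c]; exists x, l'; split => //.
  rewrite mem_heads; lia.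
rewrite IHd sl eqxx /=; lia.
Qed.

Lemma cost_ball_uniq d a s : uniq (cost_ball d a s).
Proof.
elim: d a s => [//|d IHd] a s.
apply: (@allpairs_uniq_dep _ (fun=> seq int) _ (fun x l => x :: l)) => //.
  exact: heads_uniq.
by move=> [x l] [y l'] _ _ /= [-> ->].
Qed.

Lemma size_cost_ball d a s : size (cost_ball d a s) = path_count d a.+1 2 s.
Proof.
elim: d a s => [//|d IHd] a s.
rewrite -path_count_transfer; transitivity
  (\sum_(x <- heads a s) size (cost_ball d (level x) (s - step a x)))%N.
  by rewrite -(big_map _ predT id) -sumnE; apply: size_allpairs_dep.
have iotaE m : iota 0 m = index_iota 0 m by rewrite /index_iota subn0.
rewrite big_cat !big_map !iotaE !big_mkord.
by congr (_ + _)%N; apply: eq_bigr => n _; rewrite IHd.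
Qed.

(** * The counting function in the basis of binomial coefficients *)

Section ClosedForm.
Variable F : numFieldType.
Implicit Types (d k A B s : nat).

(* The coefficients of [path_count] on the C(s, k), by Lagrange inversion. *)
Definition path_coef d k A B : F :=
  if d is e.+1 then
    (A%:R * (d + B)%:R * 'C(e + A, A + k)%:R
     + B%:R * k%:R * 'C(d + A, A + k)%:R)
    * 'C(e + B + k, k)%:R / (d%:R * (d + B)%:R)
  else (k == 0)%:R.

Arguments path_coef : simpl never.

Lemma bin_nextr n k :
  (k.+1%:R * 'C(n, k.+1)%:R = (n%:R - k%:R) * 'C(n, k)%:R :> F).
Proof.
have [le_kn|lt_nk] := leqP k n; last first.
  by rewrite !bin_small ?mulr0 ?ltnS ?(ltnW lt_nk).
by rewrite -natrM mul_bin_left natrM natrB.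
Qed.

Lemma bin_nextrl n k :
  (k.+1%:R * 'C(n.+1, k.+1)%:R = n.+1%:R * 'C(n, k)%:R :> F).
Proof. by rewrite -!natrM mul_bin_diag. Qed.

Lemma bin_nextl n k :
  (n.+1%:R * 'C(n, k)%:R = (n.+1%:R - k%:R) * 'C(n.+1, k)%:R :> F).
Proof. by rewrite -bin_nextrl bin_nextr. Qed.

Lemma path_coef1 k A B : path_coef 1 k A B =
  (if k is k'.+1 then (k' == 0)%:R * B%:R else A%:R).
Proof.
rewrite /path_coef; have B1 : (1 + B)%:R != 0 :> F by rewrite pnatr_eq0.
case: k => [|[|k]].
- by rewrite !addn0 !add0n binn bin0 mulr0 mul0r addr0 !mulr1 mul1r mulfK.
- rewrite !addn1 !add0n bin_small // binn bin1 mulr0 add0r !mulr1 !mul1r.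
  by rewrite -add1n mulfK.
- have small n : (n <= A.+1)%N -> 'C(n, A + k.+2) = 0 :> nat.
    by move=> n_le; rewrite bin_small //; lia.
  by rewrite !small ?mulr0 ?add0r ?mul0r.
Qed.

Lemma path_coefSl d k A B :
  path_coef d.+1 k A.+1 B = path_coef d.+1 k A B + path_coef d k A.+1 B.+1.
Proof.
case: d => [|d].
  by rewrite !path_coef1; case: k => [|k]; rewrite /= ?addr0 // -[in LHS]addn1 natrD.
rewrite /path_coef.
(* The three coefficients share the factor [y] and their other binomials are rational multiples of
   [x], which leaves an identity of rational functions. *)
have -> : (d + B.+1 + k = d.+1 + B + k)%N by lia.
set y := ('C(d.+1 + B + k, k)%:R : F).
rewrite !addSn !addnS; set n := (d + A)%N; set m := (A + k)%N.
set x := ('C(n.+2, m)%:R : F).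
have e1 : 'C(n.+1, m)%:R = (n.+2%:R - m%:R) * x / n.+2%:R.
  by rewrite -bin_nextl mulrC mulKf // pnatr_eq0.
have e2 : 'C(n.+1, m.+1)%:R = (n.+1%:R - m%:R) * 'C(n.+1, m)%:R / m.+1%:R :> F.
  by rewrite -bin_nextr mulrC mulKf // pnatr_eq0.
have e3 : 'C(n.+2, m.+1)%:R = (n.+2%:R - m%:R) * x / m.+1%:R :> F.
  by rewrite -bin_nextr mulrC mulKf // pnatr_eq0.
have e4 : 'C(n.+3, m.+1)%:R = n.+3%:R * x / m.+1%:R :> F.
  by rewrite -bin_nextrl mulrC mulKf // pnatr_eq0.
rewrite e4 e3 e2 e1 /n /m.
by field; rewrite !lt0r_neq0 ?ltr_wpDr ?addr_ge0 ?ler0n ?ltr01 ?ltr0n.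
Qed.

(** The counterpart of [path_countSr] at A = 0. Summation over n < s turns C(n, k) into C(s, k+1),
    hence the shift of k. *)
Lemma path_coefSr d k B :
  path_coef d.+1 k.+1 0 B.+1 = path_coef d.+1 k.+1 0 B + path_coef d k 1 B.+2.
Proof.
case: d => [|d].
  by rewrite !path_coef1 /=; case: k => [|k] /=; rewrite ?mul0r ?addr0 ?mul1r ?natr1.
rewrite /path_coef !mul0r !add0r.
have -> : (d.+1 + B.+1 + k.+1 = (d.+1 + B + k.+1).+1)%N by lia.
have -> : (d + B.+2 + k = d.+1 + B + k.+1)%N by lia.
have -> : (d.+1 + B + k.+1 = (d.+1 + B + k).+1)%N by lia.
set n := (d.+1 + B + k)%N; set y := ('C(n.+1, k)%:R : F).
rewrite !addn0 add0n add1n !addn1; set x := ('C(d.+1, k)%:R : F).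
have e1 : 'C(n.+1, k.+1)%:R = (n.+1%:R - k%:R) * y / k.+1%:R.
  by rewrite -bin_nextr mulrC mulKf // pnatr_eq0.
have e2 : 'C(n.+2, k.+1)%:R = n.+2%:R * y / k.+1%:R.
  by rewrite -bin_nextrl mulrC mulKf // pnatr_eq0.
have e3 : 'C(d.+1, k.+1)%:R = (d.+1%:R - k%:R) * x / k.+1%:R.
  by rewrite -bin_nextr mulrC mulKf // pnatr_eq0.
have e4 : 'C(d.+2, k.+1)%:R = d.+2%:R * x / k.+1%:R.
  by rewrite -bin_nextrl mulrC mulKf // pnatr_eq0.
rewrite e4 e3 e2 e1 /n.
by field; rewrite !lt0r_neq0 ?ltr_wpDr ?addr_ge0 ?ler0n ?ltr01 ?ltr0n.
Qed.

Lemma sum_bin_col k s : (\sum_(n < s) 'C(n, k) = 'C(s, k.+1))%N.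
Proof.
by elim: s => [|s IHs]; rewrite ?big_ord0 // big_ord_recr IHs binS.
Qed.

(** The terms with k > s vanish, so one bound N serves s and all the smaller n that occur in the
    induction. *)
Lemma path_countE N d A B s : (s < N)%N ->
  (path_count d A B s)%:R = \sum_(k < N) path_coef d k A B * 'C(s, k)%:R :> F.
Proof.
move=> lt_sN; elim: d A B s lt_sN => [|d IHd] A B s lt_sN.
  case: N lt_sN => [//|N] _; rewrite big_ord_recl /= bin0 mulr1 big1 ?addr0 //.
  by move=> k _; rewrite mul0r.
have sumA k : \sum_(i < A) path_coef d k i.+1 B.+1
              = path_coef d.+1 k A B - path_coef d.+1 k 0 B.
  elim: (A) => [|a IHa]; first by rewrite big_ord0 subrr.
  by rewrite big_ord_recr /= IHa path_coefSl addrAC.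
have sumB k : \sum_(j < B) path_coef d k 1 j.+2 = path_coef d.+1 k.+1 0 B.
  elim: (B) => [|b IHb].
    by rewrite big_ord0 /path_coef !mul0r addr0 !mul0r.
  by rewrite big_ord_recr /= IHb path_coefSr.
rewrite path_countS natrD !natr_sum.
under eq_bigr => i _ do rewrite IHd //.
under [X in _ + X]eq_bigr => j _.
  rewrite natr_sum; under eq_bigr => n _ do
    rewrite (IHd _ _ _ (ltn_trans (ltn_ord n) lt_sN)).
  rewrite exchange_big /=; under eq_bigr => k _ do
    rewrite -mulr_sumr -natr_sum sum_bin_col.
  over.
rewrite exchange_big [X in _ + X]exchange_big /=.
under eq_bigr => k _ do rewrite -mulr_suml sumA mulrBl.
under [X in _ + X]eq_bigr => k _ do rewrite -mulr_suml sumB.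
(* Telescoping in A leaves - [G k], telescoping in B gives [G k.+1] with the same C(s, k+1). The two
   sums cancel because [G 0] = 0, by the factor k, and [G N] = 0, by s < N. *)
pose G k := path_coef d.+1 k 0 B * 'C(s, k)%:R.
have shift : \sum_(k < N) G k = \sum_(k < N) G k.+1.
  have : \sum_(k < N.+1) G k = \sum_(k < N.+1) G k by [].
  rewrite {1}big_ord_recr big_ord_recl /= {2}/G bin_small // mulr0 addr0 => ->.
  by rewrite /G /path_coef !(mul0r, mulr0, add0r).
by rewrite sumrB -/(G _) shift subrK.
Qed.

(* At [x = d%:R] this is C(d, k) C(d+k+2, k) / (k+1), written as a polynomial in x
   so that the shifts x + 1 and x - 1 need no boundary cases. *)
Fixpoint stasheff_coef (k : nat) (x : F) : F :=
  if k is j.+1 then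
    stasheff_coef j x * ((x - j%:R) * (x + 3 + j%:R)) / (j.+1%:R * j.+2%:R)
  else 1.

Lemma path_coef12 d k : path_coef d k 1 2 = stasheff_coef k d%:R.
Proof.
transitivity ('C(d, k)%:R * 'C(d + k.+2, k)%:R / k.+1%:R : F); last first.
  elim: k => [|k IHk]; first by rewrite !bin0 mul1r divff ?oner_eq0.
  rewrite /= -IHk.
  have e1 : 'C(d, k.+1)%:R = (d%:R - k%:R) * 'C(d, k)%:R / k.+1%:R :> F.
    by rewrite -bin_nextr mulrC mulKf // pnatr_eq0.
  have e2 : 'C(d + k.+3, k.+1)%:R
          = (d + k.+3)%:R * 'C(d + k.+2, k)%:R / k.+1%:R :> F.
    by rewrite [(d + k.+3)%N]addnS -bin_nextrl mulrC mulKf // pnatr_eq0.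
  rewrite e1 e2.
  by field; rewrite !lt0r_neq0 ?ltr_wpDr ?addr_ge0 ?ler0n ?ltr01 ?ltr0n.
case: d => [|d].
  by case: k => [|k]; rewrite ?bin0 ?bin0n ?mul0r // mul1r divff ?oner_eq0.
rewrite /path_coef !addn1 add1n !addn2.
have -> : (d.+1 + k.+2 = (d.+2 + k).+1)%N by lia.
set y := ('C(d.+2 + k, k)%:R : F); set x := ('C(d.+1, k)%:R : F).
have e1 : 'C(d.+1, k.+1)%:R = (d.+1%:R - k%:R) * x / k.+1%:R.
  by rewrite -bin_nextr mulrC mulKf // pnatr_eq0.
have e2 : 'C(d.+2, k.+1)%:R = d.+2%:R * x / k.+1%:R.
  by rewrite -bin_nextrl mulrC mulKf // pnatr_eq0.
have e3 : 'C((d.+2 + k).+1, k)%:R = (d.+2 + k).+1%:R * y / d.+3%:R.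
  by rewrite bin_nextl -addSn natrD addrK mulrC mulKf // pnatr_eq0.
rewrite e3 e2 e1.
by field; rewrite !lt0r_neq0 ?ltr_wpDr ?addr_ge0 ?ler0n ?ltr01 ?ltr0n.
Qed.

End ClosedForm.

(** * The three-term recurrence for the closed form *)

Section ThreeTerm.
Variable F : numFieldType.
Implicit Types (d k s : nat) (x : F).

(** The coefficient is a product of factors x - j and x + 3 + j, and the shift to x + 1 changes only
    the ends of the two runs. The factor x + 3 clears the denominator of the ratio. *)
Lemma stasheff_coef_succ k x :
  (x + 3) * (k.+1%:R * k.+2%:R) * stasheff_coef k.+1 (x + 1)
  = (x + 1) * (x + k%:R + 3) * (x + k%:R + 4) * stasheff_coef k x.
Proof.
elim: k => [|k IHk].
  by rewrite /=; field.
rewrite [stasheff_coef k.+2 _]/= -/(stasheff_coef k.+1 (x + 1)).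
set u := stasheff_coef k.+1 (x + 1) in IHk *.
have -> : (x + 3) * (k.+2%:R * k.+3%:R) * (u * ((x + 1 - k.+1%:R) *
    (x + 1 + 3 + k.+1%:R)) / (k.+2%:R * k.+3%:R)) =
    ((x + 3) * (k.+1%:R * k.+2%:R) * u) * (x - k%:R) * (x + 5 + k%:R)
    / (k.+1%:R * k.+2%:R).
  by field; rewrite !lt0r_neq0 ?ltr_wpDr ?addr_ge0 ?ler0n ?ltr01 ?ltr0n.
rewrite IHk /=.
by field; rewrite !lt0r_neq0 ?ltr_wpDr ?addr_ge0 ?ler0n ?ltr01 ?ltr0n.
Qed.

(** The same comparison for the shift to x - 1, where the ratio has denominator x. *)
Lemma stasheff_coef_pred k x :
  x * (k.+1%:R * k.+2%:R) * stasheff_coef k.+1 (x - 1)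
  = (x - k%:R - 1) * (x - k%:R) * (x + 2) * stasheff_coef k x.
Proof.
elim: k => [|k IHk].
  by rewrite /=; field.
rewrite [stasheff_coef k.+2 _]/= -/(stasheff_coef k.+1 (x - 1)).
set u := stasheff_coef k.+1 (x - 1) in IHk *.
have -> : x * (k.+2%:R * k.+3%:R) * (u * ((x - 1 - k.+1%:R) *
    (x - 1 + 3 + k.+1%:R)) / (k.+2%:R * k.+3%:R)) =
    (x * (k.+1%:R * k.+2%:R) * u) * (x - k%:R - 2) * (x + 3 + k%:R)
    / (k.+1%:R * k.+2%:R).
  by field; rewrite !lt0r_neq0 ?ltr_wpDr ?addr_ge0 ?ler0n ?ltr01 ?ltr0n.
rewrite IHk /=.
by field; rewrite !lt0r_neq0 ?ltr_wpDr ?addr_ge0 ?ler0n ?ltr01 ?ltr0n.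
Qed.

(* By the two previous lemmas all terms are multiples of [stasheff_coef k x]. *)
Lemma stasheff_coef_rec k x :
  (x + 1) * (x + 3) * stasheff_coef k.+1 (x + 1)
  = (2 * x + 3) * ((2 * k%:R + 3) * stasheff_coef k.+1 x
                   + 2 * k.+1%:R * stasheff_coef k x)
    + x * (x + 2) * stasheff_coef k.+1 (x - 1).
Proof.
have kn0 : k.+1%:R * k.+2%:R != 0 :> F by rewrite -natrM pnatr_eq0.
apply: (mulfI kn0); rewrite [RHS]mulrDr.
have -> : k.+1%:R * k.+2%:R * ((x + 1) * (x + 3) * stasheff_coef k.+1 (x + 1))
  = (x + 1) * ((x + 3) * (k.+1%:R * k.+2%:R) * stasheff_coef k.+1 (x + 1)).
  by ring.
have -> : k.+1%:R * k.+2%:R * (x * (x + 2) * stasheff_coef k.+1 (x - 1))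
  = (x + 2) * (x * (k.+1%:R * k.+2%:R) * stasheff_coef k.+1 (x - 1)).
  by ring.
rewrite stasheff_coef_succ stasheff_coef_pred /=.
by field; rewrite !lt0r_neq0 ?ltr_wpDr ?addr_ge0 ?ler0n ?ltr01 ?ltr0n.
Qed.

Arguments stasheff_coef : simpl never.

(** Since (2s+1) C(s,k) = (2k+1) C(s,k) + 2(k+1) C(s,k+1), multiplication by 2s + 1 acts on the
    coefficients, and [stasheff_coef_rec] applies to each C(s, k+1). *)
Lemma stasheff_sum_rec s x :
  let S y := \sum_(k < s.+1) stasheff_coef k y * 'C(s, k)%:R in
  (x + 1) * (x + 3) * S (x + 1)
  = (2 * x + 3) * (2 * s%:R + 1) * S x + x * (x + 2) * S (x - 1).
Proof.
move=> S.
have S0 y : S y = 1 + \sum_(k < s) stasheff_coef k.+1 y * 'C(s, k.+1)%:R.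
  by rewrite /S big_ord_recl bin0 mulr1.
have -> : (2 * x + 3) * (2 * s%:R + 1) * S x = (2 * x + 3) * (1 +
    \sum_(k < s) ((2 * k%:R + 3) * stasheff_coef k.+1 x
                   + 2 * k.+1%:R * stasheff_coef k x) * 'C(s, k.+1)%:R).
  rewrite -mulrA; congr (_ * _); rewrite mulr_sumr.
  transitivity (\sum_(k < s.+1) ((2 * k%:R + 1) * stasheff_coef k x * 'C(s, k)%:R
    + 2 * k.+1%:R * stasheff_coef k x * 'C(s, k.+1)%:R)).
    apply: eq_bigr => k _.
    have -> : 2 * k.+1%:R * stasheff_coef k x * 'C(s, k.+1)%:R
        = 2 * stasheff_coef k x * (k.+1%:R * 'C(s, k.+1)%:R) by ring.
    rewrite bin_nextr; ring.
  rewrite big_split /= [X in X + _]big_ord_recl [X in _ + X]big_ord_recr /=.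
  rewrite (@bin_small s s.+1) // bin0 !mulr0 add0r !mulr1 addr0 -addrA -big_split.
  congr (_ + _); apply: eq_bigr => k _; rewrite /= /bump add1n; ring.
have distr a (f : 'I_s -> F) :
    a * (1 + \sum_(k < s) f k) = a + \sum_(k < s) a * f k.
  by rewrite mulrDr mulr1 mulr_sumr.
rewrite !S0 !distr addrACA -big_split /=; congr (_ + _); first by ring.
apply: eq_bigr => k _; rewrite mulrA stasheff_coef_rec; ring.
Qed.

(** The recurrence of the theorem at degree e + 1. For e = 0 its second coefficient vanishes, so the
    default 0 is harmless. *)
Fixpoint stasheff_poly (d : nat) : {poly F} :=
  if d is e.+1 then
    ((2 * e%:R + 3) / ((e%:R + 1) * (e%:R + 3)))
    *: ((2%:P * 'X + 1) * stasheff_poly e)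
    + ((e%:R * (e%:R + 2)) / ((e%:R + 1) * (e%:R + 3)))
      *: (if e is f.+1 then stasheff_poly f else 0)
  else 1.

Arguments stasheff_poly : simpl never.

Lemma stasheff_polyS d : stasheff_poly d.+1 =
  ((2 * d%:R + 3) / ((d%:R + 1) * (d%:R + 3)))
    *: ((2%:P * 'X + 1) * stasheff_poly d)
  + ((d%:R * (d%:R + 2)) / ((d%:R + 1) * (d%:R + 3)))
    *: (if d is e.+1 then stasheff_poly e else 0).
Proof. by []. Qed.

Lemma horner_stasheff_polyS d m : (stasheff_poly d.+1).[m] =
  (2 * d%:R + 3) / ((d%:R + 1) * (d%:R + 3)) * ((2 * m + 1) * (stasheff_poly d).[m])
  + (d%:R * (d%:R + 2)) / ((d%:R + 1) * (d%:R + 3))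
    * (if d is e.+1 then stasheff_poly e else 0).[m].
Proof.
by rewrite stasheff_polyS hornerD !hornerZ hornerM hornerD hornerM hornerX !hornerC.
Qed.

Lemma stasheff_polyE d s :
  (stasheff_poly d).[s%:R] = (path_count d 1 2 s)%:R.
Proof.
elim/ltn_ind: d => -[_|d IHd]; first by rewrite hornerC.
have IH e : (e <= d)%N -> (stasheff_poly e).[s%:R]
    = \sum_(k < s.+1) stasheff_coef k e%:R * 'C(s, k)%:R.
  move=> le_ed; rewrite IHd // (path_countE F _ _ _ (ltnSn s)).
  by under eq_bigr => k _ do rewrite path_coef12.
rewrite (path_countE F _ _ _ (ltnSn s)).
under eq_bigr => k _ do rewrite path_coef12 -natr1.
have d13 : (d%:R + 1) * (d%:R + 3) != 0 :> F.
  by rewrite -natrD natr1 -natrM pnatr_eq0 addn3.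
apply: (mulfI d13); rewrite (stasheff_sum_rec s d%:R).
rewrite horner_stasheff_polyS (IH d) //.
set S0 := \sum_(k < s.+1) _; set g := (if _ is _.+1 then _ else _).[_].
set S1 := \sum_(k < s.+1) _.
(* The factor d kills the default branch and the sum at -1 when d = 0. *)
have g_eq : d%:R * g = d%:R * S1.
  rewrite /g /S1; case: d {IHd d13 S0 g S1} IH => [|d] IH; first by rewrite !mul0r.
  by rewrite IH // -natr1 addrK.
transitivity ((2 * d%:R + 3) * (2 * s%:R + 1) * S0 + (d%:R + 2) * (d%:R * g)).
  by field; rewrite andbC -negb_or -mulf_eq0.
by rewrite g_eq mulrA [(_ + 2) * _]mulrC.
Qed.
End ThreeTerm.

(** * The gauge of the polytope *)

Section Gauge.
Variable R : realDomainType.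
Implicit Types (a b c t u : R).

(* Shifting the negative part of each coordinate to the next term of the sum turns
   the terms of [cost] into the convex functions [hinge], see [gauge_cost]. *)
Definition hinge a b : R := Num.max (Num.max b 0 - a) 0.

(** The closing term [hinge a 0] = max(-a, 0) charges the negative part of the last coordinate. *)
Fixpoint gauge a (l : seq R) : R :=
  if l is x :: l' then hinge a x + gauge x l' else hinge a 0.

Lemma hinge_le a b c : (hinge a b <= c) = [&& b - a <= c, - a <= c & 0 <= c].
Proof. by rewrite /hinge ge_max lerBlDr ge_max -!lerBlDr sub0r andbA. Qed.

(** [hinge] is the maximum of the linear forms b - a, - a and 0. *)
Lemma hinge_sublinear t u a b a' b' : 0 <= t -> 0 <= u ->
  hinge (t * a + u * a') (t * b + u * b') <= t * hinge a b + u * hinge a' b'.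
Proof.
move=> t0 u0; have := lexx (hinge a' b'); have := lexx (hinge a b).
rewrite !hinge_le => /and3P[h1 h2 h3] /and3P[h1' h2' h3'].
apply/and3P; split; last by rewrite addr_ge0 ?mulr_ge0.
  have -> : t * b + u * b' - (t * a + u * a') = t * (b - a) + u * (b' - a') by ring.
  by rewrite lerD ?ler_wpM2l.
have -> : - (t * a + u * a') = t * - a + u * - a' by ring.
by rewrite lerD ?ler_wpM2l.
Qed.

Lemma gauge_sublinear (I : Type) (s : seq I) (f g : I -> R) t u a b :
  0 <= t -> 0 <= u ->
  gauge (t * a + u * b) [seq t * f i + u * g i | i <- s]
  <= t * gauge a (map f s) + u * gauge b (map g s).
Proof.
move=> t0 u0; elim: s a b => [|i s IHs] a b /=.
  by have := hinge_sublinear a 0 b 0 t0 u0; rewrite !mulr0 addr0.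
by rewrite !mulrDr addrACA lerD ?hinge_sublinear.
Qed.

Lemma intr_max (x y : int) : (Num.max x y)%:~R = Num.max x%:~R y%:~R :> R.
Proof. by rewrite !maxEle ler_int; case: ifP. Qed.

Lemma hinge_intr (a b : int) :
  hinge a%:~R b%:~R = (Num.max (Num.max b 0 - a) 0)%:~R.
Proof. by rewrite intr_max intrB intr_max. Qed.

End Gauge.

Lemma gauge_intr (R : realDomainType) (a : int) (l : seq int) :
  gauge a%:~R (map intr l) = (gauge a l)%:~R :> R.
Proof.
elim: l a => [|x l IHl] a /=; first by rewrite (hinge_intr R a 0).
by rewrite hinge_intr IHl intrD.
Qed.

(** The first hinge contains the negative part of a, which [cost] charges one step earlier; this
    extra term vanishes at the start a = 0. *)
Lemma gauge_cost (a : int) (l : seq int) :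
  gauge a l = (cost (level a) l)%:Z + Num.max (- a) 0.
Proof.
elim: l a => [|x l IHl] a /=; first by rewrite /hinge maxxx add0r; lia.
by rewrite IHl /hinge; case: a => a; case: x => x /=; lia.
Qed.

(** * Vectors as lists, and the cost of the vertices *)

Definition row_seq (T : Type) d (v : 'rV[T]_d) : seq T :=
  [seq v 0 i | i <- enum 'I_d].

Definition seq_row d (l : seq int) : 'rV[int]_d := \row_j l`_j.

Lemma size_row_seq T d (v : 'rV[T]_d) : size (row_seq v) = d.
Proof. by rewrite size_map size_enum_ord. Qed.

Lemma nth_row_seq d (v : 'rV[int]_d) (j : 'I_d) : (row_seq v)`_j = v 0 j.
Proof. by rewrite (nth_map j) ?size_enum_ord // nth_ord_enum. Qed.

Lemma row_seqK d (v : 'rV[int]_d) : seq_row d (row_seq v) = v.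
Proof. by apply/rowP => j; rewrite mxE nth_row_seq. Qed.

Lemma seq_rowK d l : size l = d -> row_seq (seq_row d l) = l.
Proof.
move=> sl; apply: (@eq_from_nth _ 0) => [|i]; rewrite size_row_seq // => lt_id.
by rewrite (nth_row_seq _ (Ordinal lt_id)) mxE.
Qed.

Definition block (R : pzRingType) d i m : 'rV[R]_d :=
  \row_(j < d) (i <= j < m)%N%:R.
Arguments block : clear implicits.

Lemma row_seq_map d (T U : Type) (f : nat -> T) (g : T -> U) :
  row_seq (\row_(j < d) g (f j)) = [seq g (f j) | j <- iota 0 d].
Proof.
by rewrite -val_enum_ord -map_comp; apply: eq_map => j; rewrite mxE.
Qed.

Lemma cost_block i m d :
  (cost 0 (row_seq (block int d i m)) <= 1)%N.
Proof.
rewrite (row_seq_map d (fun j => (i <= j < m)%N) (fun b : bool => b%:R : int)).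
(* From position k on, the level is 1 exactly if k - 1 lies in [i, m), and a unit is still to be
   paid only if the interval has not opened yet. *)
suff H n k : (cost (i < k <= m) [seq (i <= j < m)%N%:R : int | j <- iota k n]
              <= (k <= i))%N by apply: leq_trans (H d 0%N) (leq_b1 _).
elim: n k => [//|n IHn] k /=.
have -> : ((i <= k < m)%N%:R = Posz (i <= k < m)%N)%R.
  by case: (_ && _).
have := IHn k.+1; rewrite /= !ltnS; lia.
Qed.

Lemma cost_opp_block i d :
  (cost 0 (row_seq (- block int d i i.+1)) <= 1)%N.
Proof.
have -> : - block int d i i.+1 =
    \row_(j < d) (fun b : bool => - b%:R : int) (i <= j < i.+1)%N.
  by apply/rowP => j; rewrite !mxE.
rewrite (row_seq_map d (fun j => (i <= j < i.+1)%N) (fun b : bool => - b%:R : int)).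
suff H n k : (cost 0 [seq - (i <= j < i.+1)%N%:R : int | j <- iota k n]
              <= (k <= i))%N by apply: leq_trans (H d 0%N) (leq_b1 _).
elim: n k => [//|n IHn] k /=; have := IHn k.+1.
by case: (boolP (i <= k < i.+1)%N) => /= ?; lia.
Qed.

(** * Lattice points of the dilates *)

Section Polytope.
Variables (R : realType) (d : nat).
Local Notation P := (stasheff_dual R d).

Lemma block_basis (i : 'I_d) : block R d i i.+1 = std_basis R i.
Proof.
by apply/rowP => j; rewrite !mxE ltnS -eqn_leq eqxx /= eq_sym.
Qed.

Lemma block_sum (i j : 'I_d) :
  block R d i j.+1 = \sum_(k < d | (i <= k <= j)%N) std_basis R k.
Proof.
apply/rowP => k; rewrite mxE summxE (eq_bigr (fun l => (l == k)%:R)); last first.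
  by move=> l _; rewrite mxE eqxx eq_sym.
rewrite ltnS; case: (boolP (i <= k <= j)%N) => [ikj|nikj].
  by rewrite (bigD1 k) //= eqxx big1 ?addr0 // => l /andP[_ /negPf->].
by rewrite big1 // => l; case: eqP => [->|//]; rewrite (negPf nikj).
Qed.

Lemma map_block i m : map_mx intr (block int d i m) = block R d i m.
Proof. by apply/rowP => k; rewrite !mxE; case: (_ && _). Qed.

Lemma stasheff_vertices_block v : stasheff_vertices R d v ->
  exists z : 'rV[int]_d, v = map_mx intr z /\ (cost 0 (row_seq z) <= 1)%N.
Proof.
move=> [[i [|]->]|[i [j [_ ->]]]].
- exists (block int d i i.+1); split; last exact: cost_block.
  by rewrite map_block block_basis.
- exists (- block int d i i.+1); split; last exact: cost_opp_block.
  by rewrite map_mxN map_block block_basis.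
- exists (block int d i j.+1); split; last exact: cost_block.
  by rewrite map_block block_sum.
Qed.

Lemma gauge_lattice (z : 'rV[int]_d) :
  gauge 0 (row_seq (map_mx intr z)) = (cost 0 (row_seq z))%:R :> R.
Proof.
have -> : row_seq (map_mx intr z) = map intr (row_seq z) :> seq R.
  by rewrite -map_comp; apply: eq_map => j; rewrite mxE.
by rewrite (gauge_intr R 0) gauge_cost /= maxxx addr0.
Qed.

Lemma gauge_lincomb (t u : R) (x y : 'rV[R]_d) : 0 <= t -> 0 <= u ->
  gauge 0 (row_seq (t *: x + u *: y))
  <= t * gauge 0 (row_seq x) + u * gauge 0 (row_seq y).
Proof.
move=> t0 u0.
have -> : row_seq (t *: x + u *: y)
    = [seq t * x 0 i + u * y 0 i | i <- enum 'I_d].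
  by apply: eq_map => j; rewrite !mxE.
have := gauge_sublinear (enum 'I_d) (x 0) (y 0) 0 0 t0 u0.
by rewrite !mulr0 addr0.
Qed.

(** A sublevel set of a sublinear function is convex, so it suffices to bound the gauge on the
    vertices. *)
Lemma stasheff_dual_gauge x : P x -> gauge 0 (row_seq x) <= 1.
Proof.
apply: (@smallest_sub _ _ _ [set x | gauge 0 (row_seq x) <= 1]) => [y z t|v].
  rewrite !inE /= => y1 z1.
  have t0 : 0 <= t%:inum by [].
  have t1 : 0 <= 1 - t%:inum by rewrite subr_ge0.
  apply: le_trans (gauge_lincomb _ _ t0 t1) _.
  apply: (@le_trans _ _ (t%:inum * 1 + (1 - t%:inum) * 1)).
    by rewrite lerD ?ler_wpM2l.
  by rewrite !mulr1 addrC subrK.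
by move=> /stasheff_vertices_block[z [-> z1]]; rewrite /= gauge_lattice lern1.
Qed.

Lemma stasheff_dual_conv (t : R) x y : 0 <= t <= 1 -> P x -> P y ->
  P (t *: x + (1 - t) *: y).
Proof.
move=> /andP[t0 t1] Px Py A [cA vA].
have := cA x y (Itv01 t0 t1); rewrite !inE; apply.
  exact: Px.
exact: Py.
Qed.

Lemma vertex_mem v : stasheff_vertices R d v -> P v.
Proof. exact: sub_gen_smallest. Qed.

Hypothesis d_gt0 : (0 < d)%N.

Lemma stasheff_dual0 : P 0.
Proof.
pose e := std_basis R (Ordinal d_gt0).
have Pe : P e by apply: vertex_mem; left; exists (Ordinal d_gt0); left.
have Pne : P (- e) by apply: vertex_mem; left; exists (Ordinal d_gt0); right.
(* The origin is the midpoint of e and - e. *)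
have h : 0 <= (2^-1 : R) <= 1.
  by rewrite invr_ge0 ler0n invf_le1 ?ltr0n // ler1n.
have := stasheff_dual_conv h Pe Pne.
by rewrite scalerN -scalerBl (_ : 2^-1 - (1 - 2^-1) = 0) ?scale0r //; field.
Qed.

Definition dilate (s : nat) (w : 'rV[R]_d) : Prop := exists2 x, P x & s%:R *: x = w.

Lemma dilate0 s : dilate s 0.
Proof. by exists 0; [exact: stasheff_dual0 | rewrite scaler0]. Qed.

Lemma dilateD s t v w : dilate s v -> dilate t w -> dilate (s + t) (v + w).
Proof.
move=> [x Px <-] [y Py <-].
have [st0|st_gt0] := posnP (s + t).
  have [s0 t0] : s = 0%N /\ t = 0%N by lia.
  by rewrite s0 t0 !scale0r addr0; apply: dilate0.
have stn0 : (s + t)%:R != 0 :> R by rewrite pnatr_eq0 -lt0n.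
(* With r = s / (s + t), s x + t y = (s + t) (r x + (1 - r) y). *)
pose r : R := s%:R / (s + t)%:R.
have r01 : 0 <= r <= 1.
  by rewrite divr_ge0 ?ler0n //= ler_pdivrMr ?ltr0n // mul1r ler_nat leq_addr.
exists (r *: x + (1 - r) *: y); first exact: stasheff_dual_conv.
rewrite scalerDr !scalerA mulrBr mulr1 [_ * r]mulrC divfK //.
by rewrite natrD addrAC subrr add0r.
Qed.

Lemma dilateMn n v : P v -> dilate n (v *+ n).
Proof. by move=> Pv; exists v; rewrite // scaler_nat. Qed.

Lemma dilate_block i m : (m <= d)%N -> dilate 1 (block R d i m).
Proof.
move=> le_md; have [le_mi|lt_im] := leqP m i.
  rewrite (_ : block _ _ _ _ = 0); first exact: dilate0.
  by apply/rowP => j; rewrite !mxE; case: andP => // -[]; lia.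
case: m le_md lt_im => // m lt_md; rewrite ltnS => le_im.
rewrite -[block _ _ _ _]mulr1n; apply: dilateMn; apply: vertex_mem.
have lt_id := leq_ltn_trans le_im lt_md.
move: le_im; rewrite leq_eqVlt => /orP[/eqP <-|lt_im].
  by left; exists (Ordinal lt_id); left; rewrite -block_basis.
by right; exists (Ordinal lt_id), (Ordinal lt_md); rewrite -block_sum.
Qed.

Definition stack (st : seq nat) m : 'rV[R]_d := \sum_(i <- st) block R d i m.

Lemma dilate_stack st m : (m <= d)%N -> dilate (size st) (stack st m).
Proof.
move=> le_md; elim: st => [|i st IHst].
  by rewrite /stack big_nil; apply: dilate0.
rewrite /stack big_cons -/(stack st m).
exact: (@dilateD 1 (size st) _ _ (dilate_block _ le_md) IHst).
Qed.

Lemma stackS st m : all (leq^~ m) st ->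
  stack st m.+1 = stack st m + block R d m m.+1 *+ size st.
Proof.
elim: st => [|i st IHst] /=; first by rewrite /stack !big_nil addr0.
move=> /andP[le_im /IHst IH];
  rewrite /stack !big_cons -!/(stack _ _) IH mulrS addrACA.
congr (_ + _); apply/rowP => j; rewrite !mxE -natrD; congr _%:R; lia.
Qed.

Definition tail_row m (l : seq int) : 'rV[R]_d :=
  \row_(j < d) (if (m <= j)%N then l`_(j - m) else 0)%:~R.

Lemma tail_row_cons m x l :
  tail_row m (x :: l) = x%:~R *: block R d m m.+1 + tail_row m.+1 l.
Proof.
apply/rowP => j; rewrite !mxE; case: (ltngtP j m) => [lt_jm|lt_mj|->].
- by rewrite /= mulr0 addr0.
- by rewrite /= ltnNge lt_mj mulr0 add0r -(subnSK lt_mj).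
by rewrite /= ltnSn subnn mulr1 addr0.
Qed.

(* [st] lists the left ends of the intervals still open at position [m]: an
   increase of the level opens new intervals, a decrease closes some. *)
Lemma dilate_stack_tail l m st : (m + size l)%N = d -> all (leq^~ m) st ->
  dilate (size st + cost (size st) l) (stack st m + tail_row m l).
Proof.
elim: l m st => [|x l IHl] m st /=.
  rewrite addn0 => md _; rewrite addn0 (_ : tail_row m [::] = 0) ?addr0.
    by apply: dilate_stack; rewrite md.
  by apply/rowP => j; rewrite !mxE nth_nil if_same.
rewrite addnS -addSn => md st_le; have lt_md : (m < d)%N by lia.
rewrite tail_row_cons; case: x => [b|n] /=.
  (* Of the two truncated differences one is 0: either b - a intervals open at m, or the first a - b
     ones end there. Only openings cost; the closed ones are paid for by [size st]. *)
  set a := size st; pose st' := nseq (b - a) m ++ drop (a - b) st.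
  have sz : size st' = b by rewrite size_cat size_nseq size_drop -/a; lia.
  have drop_le : all (leq^~ m) (drop (a - b) st).
    by move: st_le; rewrite -{1}(cat_take_drop (a - b) st) all_cat => /andP[].
  have st'_le : all (leq^~ m) st' by rewrite all_cat all_nseq leqnn orbT.
  have nseq0 n : stack (nseq n m) m = 0.
    rewrite /stack big_nseq; elim: n => [//|n IHn]; rewrite iterS IHn addr0.
    by apply/rowP => j; rewrite !mxE; case: andP => // -[]; lia.
  have stackE : stack st' m = stack (drop (a - b) st) m.
    by rewrite /stack big_cat /= -/(stack (nseq _ _) m) nseq0 add0r.
  have -> : stack st m + (b%:R *: block R d m m.+1 + tail_row m.+1 l)
      = stack (take (a - b) st) m + (stack st' m.+1 + tail_row m.+1 l).
    rewrite (stackS st'_le) sz stackE scaler_nat !addrA; congr (_ + _ + _).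
    by rewrite /stack -big_cat cat_take_drop.
  have -> : (a + (b - a + cost b l)
      = size (take (a - b) st) + (size st' + cost (size st') l))%N.
    rewrite sz size_take -/a; case: ifP; lia.
  apply: dilateD; first by apply: dilate_stack; apply: ltnW.
  by apply: IHl => //; apply: sub_all st'_le => i; apply: leqW.
(* A negative entry closes all open intervals and adds n + 1 copies of the vertex - e_m, with
   coordinates numbered from 0. *)
have -> : stack st m + ((Negz n)%:~R *: block R d m m.+1 + tail_row m.+1 l)
   = stack st m
     + ((- block R d m m.+1) *+ n.+1 + (stack [::] m.+1 + tail_row m.+1 l)).
  by rewrite /stack big_nil add0r NegzE rmorphN scaleNr scaler_nat mulNrn.
apply: dilateD; first by apply: dilate_stack; apply: ltnW.
apply: (@dilateD n.+1 (cost 0 l)); last exact: (IHl m.+1 [::]).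
apply: dilateMn; apply: vertex_mem; left; exists (Ordinal lt_md); right.
by rewrite -block_basis.
Qed.

(** The gauge is at most s on s P; conversely z is a point of the dilate by its cost, padded by 0 in
    the remaining dilate. *)
Lemma dilate_lattice_pointsE s :
  dilate_lattice_points P s = [set z | (cost 0 (row_seq z) <= s)%N].
Proof.
apply/seteqP; split => z /=.
  move=> [x Px sx]; rewrite -(ler_nat R) -gauge_lattice -sx.
  rewrite -[_ *: x]addr0 -[X in _ + X](scale0r 0).
  apply: le_trans (gauge_lincomb _ _ _ _) _ => //.
  by rewrite mul0r addr0 ler_piMr // stasheff_dual_gauge.
move=> cost_z.
have := @dilate_stack_tail (row_seq z) 0%N [::].
rewrite size_row_seq => /(_ erefl isT).
rewrite /stack big_nil !add0r /= add0n
  => /dilateD/(_ (dilate0 (s - cost 0 (row_seq z)))).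
rewrite subnKC // addr0 => -[x Px xE]; exists x => //; rewrite xE.
by apply/rowP => j; rewrite !mxE subn0 nth_row_seq.
Qed.

Lemma card_dilate_lattice_points s :
  (dilate_lattice_points P s #= `I_(path_count d 1 2 s))%card.
Proof.
rewrite dilate_lattice_pointsE -size_cost_ball.
set L := cost_ball d 0 s.
have nthL i : (i < size L)%N -> nth [::] L i \in L by exact: mem_nth.
have -> : [set z : 'rV[int]_d | (cost 0 (row_seq z) <= s)%N]
    = (fun i => seq_row d (nth [::] L i)) @` `I_(size L).
  apply/seteqP; split => z /=.
    move=> cz; have zL : row_seq z \in L by rewrite mem_cost_ball size_row_seq eqxx.
    exists (index (row_seq z) L); first by rewrite /= index_mem.
    by rewrite nth_index // row_seqK.
  move=> [i /= /nthL]; rewrite mem_cost_ball => /andP[/eqP sz c] <-.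
  by rewrite seq_rowK.
apply: inj_card_eq => i j; rewrite !inE /= => ltiL ltjL.
have /nthL := ltiL; have /nthL := ltjL; rewrite !mem_cost_ball.
move=> /andP[/eqP sj _] /andP[/eqP si _] /(congr1 (@row_seq int d)).
rewrite !seq_rowK // => /eqP; rewrite nth_uniq ?cost_ball_uniq //.
by move/eqP.
Qed.

Lemma ehrhart_stasheff : ehrhart_poly P = stasheff_poly R[i] d.
Proof.
have cardE s n : (dilate_lattice_points P s #= `I_n)%card -> n = path_count d 1 2 s.
  move=> h; apply/card_eq_II; apply: card_eq_trans (card_dilate_lattice_points s).
  by rewrite card_eq_sym.
have isE : is_ehrhart_poly P (stasheff_poly R[i] d).
  move=> s; exists (path_count d 1 2 s); split; last exact: stasheff_polyE.
  exact: card_dilate_lattice_points.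
rewrite /ehrhart_poly; case: xgetP => [p _ pE|/(_ _ isE)//].
(* A nonzero difference would vanish at as many naturals as its size, one more than its degree. *)
apply/eqP; rewrite -subr_eq0; apply/negPn/negP => nz.
pose rs : seq R[i] := [seq s%:R | s <- iota 0 (size (p - stasheff_poly R[i] d))].
have := @max_poly_roots _ _ rs nz; rewrite size_map size_iota ltnn.
suff [r u] : all (root (p - stasheff_poly R[i] d)) rs /\ uniq rs by move=> /(_ r u).
split; last first.
  by rewrite map_inj_uniq ?iota_uniq // => i j /eqP; rewrite eqr_nat => /eqP.
apply/allP => _ /mapP[s _ ->]; rewrite /root hornerD hornerN subr_eq0.
by have [n [/cardE -> ->]] := pE s; rewrite stasheff_polyE.
Qed.
End Polytope.

(** * Real roots of three-term recurrences *)

Section Favard.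
Variable R : rcfType.
Implicit Types (p q r : {poly R}) (t : seq R) (n k : nat).

Lemma seq_choice (A : nat -> R -> Prop) m :
  (forall k, (k < m)%N -> exists x, A k x) ->
  exists t, size t = m /\ forall k, (k < m)%N -> A k t`_k.
Proof.
elim: m => [|m IHm] h; first by exists [::].
have [k lt_km|t [tm tA]] := IHm; first by apply: h; apply: ltnW.
have [x xA] := h m (ltnSn m); exists (rcons t x); rewrite size_rcons tm; split=> // k.
rewrite ltnS leq_eqVlt nth_rcons tm => /orP[/eqP ->|lt_km].
  by rewrite ltnn eqxx.
by rewrite lt_km; apply: tA.
Qed.

(** Exactly size t - k factors are negative, and size t + k has the same parity. *)
Lemma sgn_prod_XsubC t x k : (k <= size t)%N ->
  (forall j, (j < k)%N -> t`_j < x) ->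
  (forall j, (k <= j < size t)%N -> x < t`_j) ->
  0 < (-1) ^+ (size t + k) * (\prod_(y <- t) ('X - y%:P)).[x].
Proof.
elim: t k => [|y t IHt] k.
  by rewrite leqn0 => /eqP -> _ _; rewrite big_nil hornerC mul1r.
rewrite big_cons hornerM hornerXsubC; set v := horner _ x in IHt *.
case: k => [|k] /= le_k lo hi.
  have h : 0 < (-1) ^+ (size t + 0) * v.
    by apply: IHt => // j h; apply: (hi j.+1 h).
  have -> : (-1) ^+ ((size t).+1 + 0) * ((x - y) * v)
      = (y - x) * ((-1) ^+ (size t + 0) * v) by rewrite addSn exprS; ring.
  by rewrite mulr_gt0 // subr_gt0 (hi 0%N).
have h : 0 < (-1) ^+ (size t + k) * v.
  apply: IHt => // j h; [exact: (lo j.+1 h) | exact: (hi j.+1 h)].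
have -> : (-1) ^+ ((size t).+1 + k.+1) * ((x - y) * v)
    = (x - y) * ((-1) ^+ (size t + k) * v) by rewrite addSn addnS !exprS; ring.
by rewrite mulr_gt0 // subr_gt0 (lo 0%N).
Qed.

Lemma poly_gt0_pinfty p x : 0 < lead_coef p -> exists2 y, x < y & 0 < p.[y].
Proof.
move=> lp; have [y py] := poly_pinfty_gt_lc lp.
exists (Num.max y (x + 1)); first by rewrite lt_max ltrDl ltr01 orbT.
by apply: lt_le_trans lp (py _ _); rewrite le_max lexx.
Qed.

Lemma poly_sgn_minfty p x n : size p = n.+1 -> 0 < lead_coef p ->
  exists2 y, y < x & 0 < (-1) ^+ n * p.[y].
Proof.
move=> sp lp; pose p' := (-1) ^+ n *: (p \Po (- 'X)).
have lp' : 0 < lead_coef p'.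
  rewrite /p' lead_coefZ lead_coef_comp ?size_polyN ?size_polyX // sp /=.
  by rewrite lead_coefN lead_coefX mulrCA -exprMn mulrNN mulr1 expr1n mulr1.
have [y xy py] := poly_gt0_pinfty (- x) lp'; exists (- y); first by rewrite ltrNl.
by move: py; rewrite /p' hornerZ horner_comp hornerN hornerX.
Qed.

Record interlaced n p q t : Prop := Interlaced {
  interlaced_size : size t = n.+1;
  interlaced_sorted : sorted <%R t;
  interlaced_prod : p = lead_coef p *: \prod_(x <- t) ('X - x%:P);
  interlaced_lead : 0 < lead_coef p;
  interlaced_sgn : forall k, (k <= n)%N -> 0 < (-1) ^+ (n + k) * q.[t`_k] }.

Lemma favard_step n p q t a b : 0 < a -> 0 < b ->
  (size q <= n.+1)%N -> interlaced n p q t ->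
  exists t', interlaced n.+1 (a *: ('X * p) - b *: q) p t' /\
    forall k, (k <= n)%N -> t'`_k < t`_k < t'`_k.+1.
Proof.
move=> a0 b0 sq [st tS pE lp tq]; set r := _ - _.
have p0 : p != 0 by rewrite -lead_coef_eq0 gt_eqF.
have sp : size p = n.+2 by rewrite pE size_scale ?gt_eqF // size_prod_XsubC st.
have sXp : size (a *: ('X * p)) = n.+3.
  by rewrite size_scale ?gt_eqF // mulrC size_mulX // sp.
have lt_bq : (size (- (b *: q)) < size (a *: ('X * p)))%N.
  by rewrite sXp size_polyN size_scale ?gt_eqF // ltnS (leq_trans sq).
have sr : size r = n.+3 by rewrite /r size_polyDl.
have lr : 0 < lead_coef r.
  by rewrite /r lead_coefDl // lead_coefZ lead_coefM lead_coefX mul1r mulr_gt0.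
have rt k : (k <= n)%N -> r.[t`_k] = - (b * q.[t`_k]).
  move=> le_kn; rewrite /r hornerD hornerN !hornerZ hornerM.
  suff -> : p.[t`_k] = 0 by rewrite !mulr0 add0r.
  apply/eqP; rewrite -/(root p _) pE rootZ ?gt_eqF // root_prod_XsubC.
  by rewrite mem_nth // st ltnS.
have [lo lo_lt rlo] := poly_sgn_minfty (head 0 t) sr lr.
have [hi hi_gt rhi] := poly_gt0_pinfty (last 0 t) lr.
(* r alternates in sign along u, hence has a root in each gap. *)
pose u := lo :: rcons t hi.
have su : size u = n.+3 by rewrite /= size_rcons st.
have u_t k : (k <= n)%N -> u`_k.+1 = t`_k.
  by move=> le_kn; rewrite /= nth_rcons st ltnS le_kn.
have u_lt k : (k < n.+2)%N -> u`_k < u`_k.+1.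
  have : sorted <%R u.
    rewrite /u /=; case: (t) tS lo_lt hi_gt => [|y t1] /=.
      by move=> _ h1 h2; rewrite (lt_trans h1 h2).
    by move=> yt -> hi_y; rewrite rcons_path yt.
  by move=> /(sortedP 0) uS lt_k; apply: uS; rewrite su ltnS.
have u_sgn k : (k < n.+3)%N -> 0 < (-1) ^+ (n + k) * r.[u`_k].
  case: k => [|k]; first by rewrite addn0;
    move: rlo; rewrite !exprS !mulrA mulrNN !mul1r.
  rewrite ltnS leq_eqVlt => /orP[/eqP[->]|].
    rewrite /= nth_rcons st ltnn eqxx addnS -addSn exprD -expr2 sqrr_sign.
    by rewrite mul1r.
  rewrite ltnS => le_kn; rewrite u_t // rt // addnS exprS mulN1r mulrNN mulrCA.
  by rewrite pmulr_rgt0 // tq.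
have [|t' [st' t'P]] :=
    @seq_choice (fun k x => u`_k < x < u`_k.+1 /\ root r x) n.+2.
  move=> k lt_kn; have s1 := u_sgn k (leqW lt_kn); have := u_sgn k.+1 lt_kn.
  rewrite addnS exprS mulN1r mulNr => s2.
  have rr : r.[u`_k] * r.[u`_k.+1] < 0.
    rewrite -oppr_gt0 -mulrN -[X in 0 < X]mul1r -(sqrr_sign R (n + k)) expr2.
    by rewrite mulrACA mulrN mulr_gt0.
  have [x] := poly_ivtoo (ltW (u_lt k lt_kn)) rr.
  by rewrite inE /= => xI rx; exists x.
have inter k : (k <= n)%N -> t'`_k < t`_k < t'`_k.+1.
  move=> le_kn; have [/andP[_ h1] _] := t'P k (leqW le_kn).
  by have [/andP[h2 _] _] := t'P k.+1 le_kn; rewrite -u_t // h1.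
have t'S : sorted <%R t'.
  apply/(sortedP 0) => k; rewrite st' ltnS => lt_k.
  by have /andP[h1 h2] := inter k lt_k; apply: lt_trans h1 h2.
exists t'; split; last exact: inter.
split => //.
  apply: all_roots_prod_XsubC; first by rewrite sr st'.
    by apply/(all_nthP 0) => k; rewrite st' => /t'P[].
  by rewrite uniq_rootsE; apply: lt_sorted_uniq.
move=> k le_k; rewrite pE hornerZ mulrCA pmulr_rgt0 // -st.
have t_le i j : (i <= j)%N -> (j <= n)%N -> t`_i <= t`_j.
  move=> le_ij le_jn; rewrite (lt_sorted_leq_nth 0 tS) // inE st ltnS //.
  exact: leq_trans le_ij le_jn.
apply: sgn_prod_XsubC; first by rewrite st.
  case: k le_k => [//|k] le_k j; rewrite ltnS => le_jk.
  by apply: le_lt_trans (t_le _ _ le_jk le_k) _; have /andP[] := inter k le_k.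
move=> j; rewrite st ltnS => /andP[le_kj le_jn].
apply: lt_le_trans (t_le _ _ le_kj le_jn).
by have /andP[] := inter k (leq_trans le_kj le_jn).
Qed.
End Favard.

(** * The critical line *)

Section CriticalLine.
Local Open Scope complex_scope.
Variable R : realType.
Implicit Types (x : R) (d : nat) (t : seq R).
Local Notation C := R[i].
Local Notation H := (stasheff_poly C).
Local Notation iC := ('i%C : C).

Let A d : R := (2 * d%:R + 3) / ((d%:R + 1) * (d%:R + 3)).
Let B d : R := (d%:R * (d%:R + 2)) / ((d%:R + 1) * (d%:R + 3)).

Fixpoint critical_poly d : {poly R} :=
  if d is e.+1 then
    A e *: ('X * critical_poly e)
    - B e *: (if e is f.+1 then critical_poly f else 0)
  else 1.
Arguments critical_poly : simpl never.

Let A_gt0 d : 0 < A d.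
Proof. by rewrite divr_gt0 ?mulr_gt0 ?ltr_wpDl ?mulr_ge0 ?ler0n ?ltr0n ?ltr01. Qed.

Let B_gt0 d : 0 < B d.+1.
Proof.
by rewrite divr_gt0 ?mulr_gt0 ?ltr_wpDl ?mulr_ge0 ?ler0n ?ltr0n ?ltr01.
Qed.

Lemma interlaced_critical d : (size (critical_poly d) <= d.+1)%N /\
  exists t, interlaced d (critical_poly d.+1) (critical_poly d) t.
Proof.
elim: d => [|d [sd [t dt]]].
  split; first by rewrite size_poly1.
  have lX : lead_coef (critical_poly 1) = A 0.
    by rewrite /critical_poly scaler0 subr0 mulr1 lead_coefZ lead_coefX mulr1.
  exists [:: 0]; split => //; rewrite ?lX //.
    by rewrite big_seq1 subr0 /critical_poly scaler0 subr0 mulr1.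
  by move=> [|//] _; rewrite /critical_poly hornerC mulr1.
split.
  have [st _ pE lp _] := dt; rewrite pE size_scale ?gt_eqF //.
  by rewrite size_prod_XsubC st.
by have [t' [t'P _]] := favard_step (A_gt0 d.+1) (B_gt0 d) sd dt; exists t'.
Qed.

Definition half_i : C := 0 +i* 2^-1.

Definition critical_point x : C := - 2^-1 + x%:C * half_i.

Lemma critical_point_linear x : 2 * critical_point x + 1 = iC * x%:C.
Proof.
have half_iE : half_i = 2^-1 * iC.
  have -> : (2^-1 : C) = (2^-1 : R)%:C by rewrite fmorphV rmorph_nat.
  by rewrite /half_i; simpc.
by rewrite /critical_point half_iE; field.
Qed.

Lemma horner_critical d x :
  (H d).[critical_point x] = iC ^+ d * ((critical_poly d).[x])%:C.
Proof.
have AC e : (2 * e%:R + 3) / ((e%:R + 1) * (e%:R + 3)) = (A e)%:C :> C.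
  by rewrite /A rmorphM fmorphV !(rmorphD, rmorphM) !rmorph_nat rmorph1.
have BC e : (e%:R * (e%:R + 2)) / ((e%:R + 1) * (e%:R + 3)) = (B e)%:C :> C.
  by rewrite /B rmorphM fmorphV !(rmorphD, rmorphM) !rmorph_nat rmorph1.
elim/ltn_ind: d => -[_|d IHd].
  by rewrite /stasheff_poly /critical_poly !hornerC rmorph1 mulr1.
rewrite horner_stasheff_polyS AC BC critical_point_linear IHd //.
have -> : (critical_poly d.+1).[x] = A d * (x * (critical_poly d).[x])
    - B d * (if d is f.+1 then critical_poly f else 0).[x].
  by rewrite [critical_poly _]/= hornerD hornerN !hornerZ hornerM hornerX.
rewrite exprS rmorphB !rmorphM; case: d IHd => [|d] IHd.
  by rewrite !horner0 rmorph0 !mulr0 addr0 subr0; ring.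
by rewrite IHd 1?ltnW // exprS; have := sqr_i R; set i := iC => i2; ring: i2.
Qed.

Lemma size_stasheff_poly d : size (H d) = d.+1.
Proof.
elim/ltn_ind: d => -[_|d IHd]; first by rewrite size_poly1.
have nz (a b : nat) : (a.+1%:R + b%:R : C) != 0 by rewrite -natrD pnatr_eq0.
have s1 : size ((2 * d%:R + 3) / ((d%:R + 1) * (d%:R + 3))
    *: ((2%:P * 'X + 1) * H d) : {poly C}) = d.+2.
  rewrite size_scale; last first.
    by rewrite mulf_neq0 ?invr_eq0 ?mulf_neq0 // addrC -?natrM nz.
  have -> : 2%:P * 'X + 1 = 2 *: ('X - (- 2^-1)%:P) :> {poly C}.
    rewrite scalerBr -mul_polyC -[X in _ - X]mul_polyC.
    rewrite -polyCM mulrN divff ?pnatr_eq0 //.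
    by rewrite polyCN opprK.
  rewrite -scalerAl size_scale ?pnatr_eq0 //.
  rewrite [_ * H d]mulrC size_Mmonic ?monicXsubC //.
    by rewrite size_XsubC addn2 IHd.
  by rewrite -size_poly_eq0 IHd.
rewrite stasheff_polyS size_polyDl s1 //.
apply: leq_ltn_trans (size_scale_leq _ _) _.
case: d IHd {s1} => [|d] IHd; first by rewrite size_poly0.
by rewrite IHd // ltnW.
Qed.

Lemma critical_point_inj : injective critical_point.
Proof.
move=> x y /(congr1 (fun z => 2 * z + 1)); rewrite !critical_point_linear.
by move=> /(congr1 (@complex.Im R)) /=; rewrite !mul0r !mul1r !add0r.
Qed.

Lemma stasheff_poly_factor d t :
  size t = d -> uniq t -> all (root (critical_poly d)) t ->
  H d = lead_coef (H d) *: \prod_(z <- map critical_point t) ('X - z%:P).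
Proof.
move=> st ut rt; apply: all_roots_prod_XsubC.
- by rewrite size_stasheff_poly size_map st.
- apply/allP => _ /mapP[x xt ->]; rewrite /root horner_critical.
  by move/allP: rt => /(_ x xt) /eqP ->; rewrite rmorph0 mulr0.
by rewrite uniq_rootsE map_inj_uniq //; apply: critical_point_inj.
Qed.

Lemma zeros_stasheff_poly d t :
  size t = d -> uniq t -> all (root (critical_poly d)) t ->
  zeros_with_mult (H d) (map critical_point t).
Proof.
move=> st ut rt; have H0 : H d != 0 by rewrite -size_poly_eq0 size_stasheff_poly.
split=> // z; rewrite [in RHS](stasheff_poly_factor st ut rt) -mul_polyC.
by rewrite mupMr ?mu_prod_XsubC // rootC lead_coef_eq0.
Qed.

Lemma interlaced_roots n p q t :
  @interlaced R n p q t -> uniq t /\ all (root p) t.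
Proof.
move=> [_ tS pE lp _]; split; first exact: lt_sorted_uniq tS.
by apply/allP => x xt; rewrite pE rootZ ?gt_eqF // root_prod_XsubC.
Qed.

Lemma critical_lineE :
  critical_line R = complex_line (- 2^-1) half_i.
Proof.
have e2 : (- 2^-1 : C) = (- 2^-1 : R)%:C by rewrite rmorphN fmorphV rmorph_nat.
apply/seteqP; split => -[a b] /=.
  rewrite /critical_line /= => ->; exists (2 * b) => //.
  rewrite e2 /half_i; simpc; congr (_ +i* _).
  by rewrite mulrAC divff ?mul1r ?pnatr_eq0.
by move=> [x _]; rewrite e2 /half_i; simpc => -[<- _].
Qed.

Lemma stasheff_poly_roots d z : root (H d.+1) z -> critical_line R z.
Proof.
have [_ [t dt]] := interlaced_critical d; have [ut rt] := interlaced_roots dt.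
rewrite (stasheff_poly_factor (interlaced_size dt) ut rt) rootZ; last first.
  by rewrite lead_coef_eq0 -size_poly_eq0 size_stasheff_poly.
rewrite root_prod_XsubC => /mapP[x _ ->]; rewrite critical_lineE.
by exists x.
Qed.

Lemma stasheff_poly_interlaced d :
  line_interlaced (critical_line R) (H d.+2) (H d.+1).
Proof.
have [sd [s ds]] := interlaced_critical d; have [us rs] := interlaced_roots ds.
have [t [dt ts]] := favard_step (A_gt0 d.+1) (B_gt0 d) sd ds.
have [ut rt] := interlaced_roots dt.
have st := interlaced_size dt; have ss := interlaced_size ds.
exists (- 2^-1), half_i; split.
- by rewrite eq_complex /= eqxx /= invr_eq0 pnatr_eq0.
- exact: critical_lineE.
- by rewrite !size_stasheff_poly.
exists t, s; split.
- exact: (@zeros_stasheff_poly d.+2 t st ut rt).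
- exact: (@zeros_stasheff_poly d.+1 s ss us rs).
- by rewrite st ss.
by move=> k; rewrite ss ltnS => /ts /andP[h1 h2]; rewrite !ltW.
Qed.
End CriticalLine.

Lemma stasheff_ehrhartE (R : realType) d :
  stasheff_ehrhart R d = stasheff_poly R[i] d.
Proof. by case: d => [//|d]; apply: ehrhart_stasheff. Qed.

Theorem mainTheorem5 (R : realType) :
  (forall (d : nat) (m : R[i]), (2 <= d)%N ->
     (stasheff_ehrhart R d).[m] =
       (2 * d%:R + 1) / (d%:R * (d%:R + 2)) * (2 * m + 1)
         * (stasheff_ehrhart R d.-1).[m]
       + ((d%:R - 1) * (d%:R + 1)) / (d%:R * (d%:R + 2))
         * (stasheff_ehrhart R d.-2).[m])
  /\ (forall d : nat, (1 <= d)%N ->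
        (forall z : R[i], root (stasheff_ehrhart R d) z -> critical_line R z)
        /\ line_interlaced (critical_line R)
             (stasheff_ehrhart R d.+1) (stasheff_ehrhart R d)).
Proof.
split=> [[|[|d]] m // _|[//|d] _]; last first.
  rewrite !stasheff_ehrhartE; split; last exact: stasheff_poly_interlaced.
  exact: stasheff_poly_roots.
rewrite !stasheff_ehrhartE /= horner_stasheff_polyS -(natr1 d.+1) addrK.
have -> : 2 * (d.+1%:R + 1) + 1 = 2 * d.+1%:R + 3 :> R[i] by ring.
have -> : d.+1%:R + 1 + 1 = d.+1%:R + 2 :> R[i] by ring.
have -> : d.+1%:R + 1 + 2 = d.+1%:R + 3 :> R[i] by ring.
by rewrite mulrA.
Qed.
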